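(* Suppose online decision-making is carried out with the FRONT algorithm and that the following hold. (Boundedness) There exist positive constants $L_x,\lambda$ such that $\|\phi(\bm{x})\|_\infty\le L_x$ for all $\bm{x}\sim\mathcal{P}_X$ and $\lambda_{\min}(\mathbb{E}[\phi(\bm{x})\phi(\bm{x})^{\top}])>\lambda$. Moreover there is a positive constant $L_z\ge L_x$ such that $\sum_{s=1}^{t-1}|w_{ts}|\le L_z$ for all $t$; then $\|\bm{z}_t\|_\infty\le L_z$ for any $t$. (Clipping) There is a constant $C$ such that, for any time step $t\ge1$, $\lambda_{\min}\left\{\frac1t\sum_{s=1}^{t}\bm{z}_s\bm{z}_s^{\top}\right\}>C\epsilon_t$. If moreover $t\epsilon_t^2\to\infty$ as $t\to\infty$, then the online estimator is consistent, i.e., $\widehat{\bm{\theta}}_t\to\bm{\theta}$ as $t\to\infty$.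
   Context: Model. Individuals $t=1,2,\dots$ arrive sequentially with i.i.d. contexts $\bm{x}_t\sim\mathcal{P}_X$ on $\mathbb{R}^{d_0}$ (one coordinate is the constant $1$); an action $a_t\in\{0,1\}$ is chosen and a reward $y_t$ observed; $\mathcal{H}_t=\{\bm{x}_s,a_s,y_s\}_{s\le t}$. With a known real weight array $\{w_{ts}\}_{t\ge1,s<t}$ put $\kappa_t=\sum_{s=1}^{t-1}w_{ts}a_s$ and $\zeta_t=\sum_{s=t+1}^{\infty}w_{st}$. With a feature map $\phi:\mathbb{R}^{d_0}\to\mathbb{R}^{d_1}$ and true parameters $\bm{\beta}_0,\bm{\beta}_1\in\mathbb{R}^{d_1}$, $\gamma\in\mathbb{R}$, $$y_t=(1-a_t)\phi(\bm{x}_t)^{\top}\bm{\beta}_0+a_t\phi(\bm{x}_t)^{\top}\bm{\beta}_1+\kappa_t\gamma+e_t ,$$ the part without $e_t$ being the conditional mean of $y_t$ given $\bm{x}_t,\kappa_t,a_t$. The noise $e_t$ is $\sigma$-subgaussian and, conditionally on $a_t$, independent of $\bm{x}_t$ and $\mathcal{H}_{t-1}$; given $a_t=i$ it has distribution $\mathcal{P}_{e_i}$ with $\mathbb{E}(e_t^2\mid a_t=i)=\sigma_i^2<\sigma^2$. Put $d=2d_1+1$, $\bm{z}_t=((1-a_t)\phi(\bm{x}_t)^{\top},a_t\phi(\bm{x}_t)^{\top},\kappa_t)^{\top}\in\mathbb{R}^d$, $\bm{\theta}=(\bm{\beta}_0^{\top},\bm{\beta}_1^{\top},\gamma)^{\top}$.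 The online estimator (defined when the matrix is invertible) is $$\widehat{\bm{\theta}}_t=(\widehat{\bm{\beta}}_{0,t}^{\top},\widehat{\bm{\beta}}_{1,t}^{\top},\widehat{\gamma}_t)^{\top}=\left(\tfrac1t\sum_{s=1}^t\bm{z}_s\bm{z}_s^{\top}\right)^{-1}\left(\tfrac1t\sum_{s=1}^t\bm{z}_sy_s\right).$$ FRONT algorithm. Inputs: clipping parameter $C$ (the constant of the clipping assumption), threshold $\kappa_0$, number of force pulls $K$, warm-up length $T_0$, warm-up parameter $L$, exploration probabilities $\epsilon_t$. For $t\le T_0$ (warm-up): $a_t=1$ if $t\in\bigcup_{i=1}^{L}((i-1)T_0/L,(2i-1)T_0/(2L)]$ and $a_t=0$ if $t\in\bigcup_{i=1}^{L}((2i-1)T_0/(2L),iT_0/L]$. For $t>T_0$, unless $a_t$ has been fixed by an earlier force pull: draw $a_t\sim\mathrm{Bernoulli}(\widehat{\pi}_t(\bm{x}_t))$ with $$\widehat{\pi}_t(\bm{x}_t)=(1-\epsilon_t)\,\mathbb{I}\{\phi(\bm{x}_t)^{\top}(\widehat{\bm{\beta}}_{1,t-1}-\widehat{\bm{\beta}}_{0,t-1})+\zeta_t\widehat{\gamma}_{t-1}\ge0\}+\epsilon_t/2;$$ if then $\lambda_{\min}\{\frac1t\sum_{s=1}^t\bm{z}_s\bm{z}_s^{\top}\}\le C\epsilon_t$, perform force pulls: set $a_t=a_{t+1}=\dots=a_{t+K}$ equal to $1$ if $\kappa_t\le\kappa_0$ and to $0$ otherwise. $\lambda_{\min}$ denotes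 the smallest eigenvalue.
   Formalization: The clipping constant C is taken positive and the clipping inequality is required, almost surely, only for t > T_0: at t = 1 the matrix is singular, so no C ≥ 0 can satisfy it, and with C < 0 the claim is false. Consistency means convergence in probability. *)

(* Defs.v *)
(* Individuals are numbered from 1: the values of all the sequences below at
   index 0 are irrelevant. *)
From HB Require Import structures.
From mathcomp Require Import all_boot all_order all_algebra.
From mathcomp Require Import all_classical all_reals all_analysis.
Import numFieldNormedType.Exports.
Import Order.TTheory GRing.Theory Num.Theory.

Set Implicit Arguments.
Unset Strict Implicit.
Unset Printing Implicit Defensive.

Local Open Scope classical_set_scope.
Local Open Scope ring_scope.

Section linear_algebra.
Context {R : realType}.

Definition dot n (u v : 'cV[R]_n) : R := (u^T *m v) 0 0.

(* Only used on real symmetric matrices of positive size, whose set of (real)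
   eigenvalues is finite and nonempty, so that the infimum is a minimum. *)
Definition lambda_min n (A : 'M[R]_n) : R := inf [set r : R | eigenvalue A r].

End linear_algebra.

Section paths.
Context {R : realType} {d0 d1 : nat}.
Variables (phi : d0.-tuple R -> 'cV[R]_d1) (w : nat -> nat -> R).
Implicit Types (x : nat -> d0.-tuple R) (a : nat -> bool) (y : nat -> R).
Implicit Types (z : nat -> 'cV[R]_(d1 + d1 + 1)) (th : 'cV[R]_(d1 + d1 + 1)).

Definition kappa a (t : nat) : R := \sum_(1 <= s < t) w t s * (a s)%:R.

Definition zeta (t : nat) : R := limn (fun n => \sum_(t.+1 <= s < n) w s t).

Definition stack (b0 b1 : 'cV[R]_d1) (g : R) : 'cV[R]_(d1 + d1 + 1) :=
  col_mx (col_mx b0 b1) g%:M.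

Definition beta0_of th : 'cV[R]_d1 := usubmx (usubmx th).
Definition beta1_of th : 'cV[R]_d1 := dsubmx (usubmx th).
Definition gamma_of th : R := dsubmx th 0 0.

Definition zvec x a (t : nat) : 'cV[R]_(d1 + d1 + 1) :=
  stack ((1 - (a t)%:R) *: phi (x t)) ((a t)%:R *: phi (x t)) (kappa a t).

Definition gram z (t : nat) : 'M[R]_(d1 + d1 + 1) :=
  t%:R^-1 *: \sum_(1 <= s < t.+1) z s *m (z s)^T.

(* [invmx] returns its argument on singular matrices; the estimator is
   meaningful only when [gram z t \in unitmx]. *)
Definition theta_hat z y (t : nat) : 'cV[R]_(d1 + d1 + 1) :=
  invmx (gram z t) *m (t%:R^-1 *: \sum_(1 <= s < t.+1) y s *: z s).

Definition mean_reward (beta0 beta1 : 'cV[R]_d1) (gamma : R) x a (t : nat) : R :=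
  (1 - (a t)%:R) * dot (phi (x t)) beta0 + (a t)%:R * dot (phi (x t)) beta1
  + kappa a t * gamma.

(* [th] is the estimate available before individual [t], i.e. the one
   computed at time [t.-1]. *)
Definition pi_hat (eps : nat -> R) th (v : d0.-tuple R) (t : nat) : R :=
  (1 - eps t) *
    (0 <= dot (phi v) (beta1_of th - beta0_of th) + zeta t * gamma_of th)%R%:R
  + eps t / 2.

Definition warmup1 (T0 L t : nat) : Prop :=
  exists2 i : nat, (1 <= i <= L)%N &
    (i%:R - 1) * T0%:R / L%:R < t%:R :> R /\
    t%:R <= (2 * i%:R - 1) * T0%:R / (2 * L%:R) :> R.

Definition warmup0 (T0 L t : nat) : Prop :=
  exists2 i : nat, (1 <= i <= L)%N &
    (2 * i%:R - 1) * T0%:R / (2 * L%:R) < t%:R :> R /\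
    t%:R <= i%:R * T0%:R / L%:R :> R.

(* [pull s] says that a round of force pulls is started at time [s]; it then
   fixes the actions of individuals s, ..., s + K. *)
Definition forced (K : nat) (pull : nat -> Prop) (t : nat) : Prop :=
  exists2 s : nat, pull s & (s < t <= s + K)%N.

(* The action rules of FRONT along one trajectory: [draw t] is the outcome of
   the Bernoulli draw for individual [t], and [a t] is the action actually
   taken. The eigenvalue test at time [t] is made with the drawn action, before
   it is possibly overridden by the force pull which it triggers. *)
Record front_path (C kappa0 : R) (K T0 L : nat) (eps : nat -> R)
    x a (draw : nat -> bool) (pull : nat -> Prop) : Prop := {
  front_warmup1 : forall t, (0 < t <= T0)%N -> warmup1 T0 L t -> a t = true ;
  front_warmup0 : forall t, (0 < t <= T0)%N -> warmup0 T0 L t -> a t = false ;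
  front_pull : forall t, pull t <->
    [/\ (T0 < t)%N, ~ forced K pull t &
        lambda_min (gram (zvec x [eta a with t |-> draw t]) t) <= C * eps t] ;
  front_draw : forall t, (T0 < t)%N -> ~ forced K pull t -> ~ pull t ->
    a t = draw t ;
  front_force : forall s t, pull s -> (s <= t <= s + K)%N ->
    a t = (kappa a s <= kappa0) }.

End paths.

Section probability.
Context {d : measure_display} {Omega : measurableType d} {R : realType}.
Variable P : probability Omega R.

Definition identically_distributed d' (T : measurableType d')
    (Q : probability T R) (X : nat -> Omega -> T) : Prop :=
  forall t, (0 < t)%N -> forall B, measurable B -> P (X t @^-1` B) = Q B.

Definition mutually_independent d' (T : measurableType d')
    (X : nat -> Omega -> T) : Prop :=
  forall s : seq nat, uniq s -> all (leq 1) s ->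
  forall B : nat -> set T, (forall t, measurable (B t)) ->
  fine (P [set om | forall t, t \in s -> B t (X t om)])
  = \prod_(t <- s) fine (P (X t @^-1` B t)).

(* [M] is a version of the conditional mean of [Y] given the sub-sigma-algebra
   [G]. *)
Record is_cond_mean (G : set (set Omega)) (Y M : Omega -> R) : Prop := {
  cond_mean_integrable : P.-integrable setT (EFin \o Y) ;
  cond_mean_measurable : forall B, measurable B -> G (M @^-1` B) ;
  cond_mean_eq : forall A, G A ->
    (\int[P]_(om in A) (Y om)%:E = \int[P]_(om in A) (M om)%:E)%E }.

Definition subgaussian (sigma : R) (X : Omega -> R) : Prop :=
  forall l : R, ('M_P X l <= (expR (l ^+ 2 * sigma ^+ 2 / 2))%:E)%E.

Definition cvg_in_probability (V : normedModType R)
    (X : nat -> Omega -> V) (l : V) : Prop :=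
  forall h : R, 0 < h ->
    P [set om | h < `|X t om - l|] @[t --> \oo] --> 0%E.

End probability.

Section model.
Context {d : measure_display} {Omega : measurableType d} {R : realType}.
Variable P : probability Omega R.
Context {d0 d1 : nat}.
Variables (PX : probability (d0.-tuple R) R) (Pe : bool -> probability R R).
Variables (phi : d0.-tuple R -> 'cV[R]_d1) (w : nat -> nat -> R).
Variables (beta0 beta1 : 'cV[R]_d1) (gamma : R) (sigma : R) (sigma_ : bool -> R).
Variables (x : nat -> Omega -> d0.-tuple R) (a : nat -> Omega -> bool).
Variables (e : nat -> Omega -> R).

Definition mean (t : nat) (om : Omega) : R :=
  mean_reward phi w beta0 beta1 gamma (x ^~ om) (a ^~ om) t.

Definition reward (t : nat) (om : Omega) : R := mean t om + e t om.

(* Generators of the sigma-algebra of H_t, of that of (x_t, H_(t-1)), and of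
   that of (x_t, kappa_t, a_t). *)
Definition history (t : nat) : set (set Omega) :=
  \bigcup_(s in [set s | (0 < s <= t)%N])
    (g_sigma_algebra_preimage (x s) `|` g_sigma_algebra_preimage (a s)
     `|` g_sigma_algebra_preimage (reward s)).

Definition past (t : nat) : set (set Omega) :=
  g_sigma_algebra_preimage (x t) `|` history t.-1.

Definition covariates (t : nat) : set (set Omega) :=
  g_sigma_algebra_preimage (x t)
  `|` g_sigma_algebra_preimage (fun om => kappa w (a ^~ om) t)
  `|` g_sigma_algebra_preimage (a t).

Record bandit_model : Prop := {
  model_phi : forall i, measurable_fun setT (fun v => phi v i 0) ;
  model_x : forall t, measurable_fun setT (x t) ;
  model_a : forall t, measurable_fun setT (a t) ;
  model_e : forall t, measurable_fun setT (e t) ;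
  model_x_law : identically_distributed P PX x ;
  model_x_indep : mutually_independent P x ;
  model_intercept : exists j : 'I_d0, {ae PX, forall v, tnth v j = 1} ;
  model_cond_mean : forall t, (0 < t)%N ->
    is_cond_mean P <<s covariates t>> (reward t) (mean t) ;
  model_subgaussian : forall t, (0 < t)%N -> subgaussian P sigma (e t) ;
  (* P(e_t in B, A | a_t = i) = P(e_t in B | a_t = i) P(A | a_t = i), cleared of
     denominators so as to be void when P(a_t = i) = 0. *)
  model_noise_indep : forall t, (0 < t)%N -> forall (i : bool) (B : set R) A,
    measurable B -> <<s past t>> A ->
    (P (a t @^-1` [set i] `&` e t @^-1` B `&` A) * P (a t @^-1` [set i])
     = P (a t @^-1` [set i] `&` e t @^-1` B) * P (a t @^-1` [set i] `&` A))%E ;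
  model_noise_law : forall t, (0 < t)%N -> forall (i : bool) (B : set R),
    measurable B ->
    (P (a t @^-1` [set i] `&` e t @^-1` B) = P (a t @^-1` [set i]) * Pe i B)%E ;
  model_noise_var : forall i,
    ('E_(Pe i)[fun u : R => u ^+ 2]%R = (sigma_ i ^+ 2)%:E)%E /\
    sigma_ i ^+ 2 < sigma ^+ 2 }.

Definition features (om : Omega) : nat -> 'cV[R]_(d1 + d1 + 1) :=
  zvec phi w (x ^~ om) (a ^~ om).

Definition estimator (t : nat) (om : Omega) : 'cV[R]_(d1 + d1 + 1) :=
  theta_hat (features om) (reward ^~ om) t.

Variables (C kappa0 : R) (K T0 L : nat) (eps : nat -> R).
Variables (draw : nat -> Omega -> bool) (pull : nat -> Omega -> Prop).

Definition past_and_draws (t : nat) : set (set Omega) :=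
  past t `|`
  \bigcup_(s in [set s | (0 < s < t)%N]) g_sigma_algebra_preimage (draw s).

(* [front_bernoulli]: given the context x_t and everything that happened
   before, draw_t is Bernoulli(pi_hat_t(x_t)) on the event that a draw is made
   and that the estimator at time t - 1 is defined. *)
Record front : Prop := {
  front_eps : forall t, (T0 < t)%N -> 0 <= eps t <= 1 ;
  front_measurable_draw : forall t, measurable_fun setT (draw t) ;
  front_rules : forall om, front_path phi w C kappa0 K T0 L eps
    (x ^~ om) (a ^~ om) (draw ^~ om) (pull ^~ om) ;
  front_bernoulli : forall t, (T0 < t)%N -> forall A,
    <<s past_and_draws t>> A ->
    A `<=` [set om | ~ forced K (pull ^~ om) t /\
                     gram (features om) t.-1 \in unitmx] ->
    (P (A `&` draw t @^-1` [set true])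
     = \int[P]_(om in A) (pi_hat phi w eps (estimator t.-1 om) (x t om) t)%:E)%E }.

Definition boundedness (Lx lam Lz : R) : Prop :=
  [/\ 0 < Lx /\ 0 < lam,
      {ae PX, forall v, `|phi v| <= Lx},
      lam < lambda_min
        (\matrix_(i, j) fine 'E_PX[fun v => (phi v *m (phi v)^T)%R i j]%E),
      Lx <= Lz &
      forall t, (0 < t)%N -> \sum_(1 <= s < t) `|w t s| <= Lz].

(* Required after the warm-up only: for t < 2 d1 + 1 the matrix is singular, so
   that the inequality would fail for every C > 0 and 0 <= eps t. *)
Definition clipping : Prop :=
  0 < C /\ forall t, (T0 < t)%N ->
    {ae P, forall om, C * eps t < lambda_min (gram (features om) t)}.

End model.

(* Main.v *)
Require Import Defs.
From HB Require Import structures.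
From mathcomp Require Import all_boot all_order all_algebra.
From mathcomp Require Import all_classical all_reals all_analysis.
From mathcomp Require Import measurable_realfun ring lra.
Import numFieldNormedType.Exports.
Import Order.TTheory GRing.Theory Num.Theory.

Local Open Scope classical_set_scope.
Local Open Scope ring_scope.

(* The estimation error is [G^-1 (1/t) sum_(s <= t) e_s z_s], where [G] is the
   Gram matrix. Since [lambda_min G > C eps_t], its Euclidean norm is at most
   [|sum_(s <= t) e_s z_s| / (t C eps_t)]. Given [a_s], the noise [e_s] is
   centred and independent of the context [x_s] and of the history, so that the
   [e_s z_s] are pairwise orthogonal with bounded second moments and
   [E |sum_(s <= t) e_s z_s|^2 = O(t)]. By Markov's inequality the error exceeds
   a given threshold with probability [O(1 / (t eps_t^2))]. *)

(** The features [z_s] contain the action [a_s], which need not be a function of the past, whereas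
    [e_s] is independent of the past only given [a_s]. Orthogonality is therefore proved on each
    event [a_s = i] separately, under the restriction of [P] to it: there [a_s] may be replaced by
    the constant [i], and the features become a function of the past. That the noise is centred on
    such an event follows from the conditional mean of the reward, the event being in the
    sigma-algebra of the covariates. As the contexts are bounded only almost surely, the features
    are truncated at [Lz]; this bounds second moments on the whole space and preserves measurability
    with respect to the past. Almost surely the truncated sum is the true one, which is enough to
    bound the probability of a deviation. *)

(** * Variational bound for the smallest eigenvalue *)

Section rayleigh.
Set Implicit Arguments.
Unset Strict Implicit.
Context {R : realType}.

(** Row vectors are used because [eigenvalue] refers to left eigenvectors. With [A = 1%:M] this is
    the squared Euclidean norm, the norm of matrices being the sup norm. *)
Definition qform n (A : 'M[R]_n) (u : 'rV[R]_n) : R := (u *m A *m u^T) 0 0.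

Lemma qformE n (A : 'M[R]_n) u :
  qform A u = \sum_j (\sum_i u 0 i * A i j) * u 0 j.
Proof. by rewrite /qform mxE; apply: eq_bigr => j _; rewrite !mxE. Qed.

Lemma qform1E n (u : 'rV[R]_n) : qform 1%:M u = \sum_j u 0 j ^+ 2.
Proof.
by rewrite /qform mulmx1 mxE; apply: eq_bigr => j _; rewrite mxE expr2.
Qed.

Lemma qform1_ge0 n (u : 'rV[R]_n) : 0 <= qform 1%:M u.
Proof. by rewrite qform1E sumr_ge0// => j _; rewrite sqr_ge0. Qed.

Lemma qform1_eq0 n (u : 'rV[R]_n) : qform 1%:M u = 0 -> u = 0.
Proof.
rewrite qform1E => /eqP; rewrite psumr_eq0; last by move=> *; rewrite sqr_ge0.
move=> /allP u0; apply/rowP => j; rewrite mxE; apply/eqP.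
by rewrite -sqrf_eq0; apply: u0; rewrite mem_index_enum.
Qed.

Lemma qformZ n (A : 'M[R]_n) k u : qform A (k *: u) = k ^+ 2 * qform A u.
Proof.
by rewrite /qform linearZ/= -!scalemxAl -scalemxAr scalerA mxE expr2.
Qed.

Lemma continuous_qform n (A : 'M[R]_n) : continuous (qform A).
Proof.
have coo j : continuous (fun v : 'rV[R]_n => v 0 j).
  exact: coord_continuous.
rewrite (_ : qform A = fun v => \sum_j (\sum_i v 0 i * A i j) * v 0 j).
  have sumc (F : 'I_n -> 'rV[R]_n -> R) : (forall i, continuous (F i)) ->
      continuous (fun v => \sum_i F i v).
    move=> cF; apply: continuous_big => [|i _]; last exact: cF.
    exact: add_continuous.
  apply: (sumc _) => j v; apply: continuousM; last exact: coo.
  by apply: sumc => i {}v; apply: continuousM; [exact: coo|exact: cst_continuous].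
by apply/funext => v; rewrite qformE.
Qed.

Lemma compact_sphere n : compact [set u : 'rV[R]_n | qform 1%:M u = 1].
Proof.
apply: bounded_closed_compact.
  exists 1; split; first exact: num_real.
  move=> M M1 u /= u1; apply/ltW; apply: le_lt_trans M1.
  rewrite [X in X <= _]mx_normrE; apply/bigmax_leP; split => //= -[i j] _ /=.
  rewrite (ord1 i) -(@ler_pXn2r _ 2)// ?nnegrE//.
  rewrite expr1n real_normK ?num_real// -u1 qform1E (bigD1 j)//= lerDl.
  by apply: sumr_ge0 => k _; rewrite sqr_ge0.
rewrite (_ : [set u | _] = qform 1%:M @^-1` [set 1])//.
by apply: closed_comp; [move=> ? _; exact: continuous_qform|exact: closed_eq].
Qed.

(* With [v = u B], [qform B (u - s v) = s^2 qform B v - 2 s |v|^2] is negative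
   for small [s > 0] unless [v = 0]. *)
Lemma psd_qform_eq0 n (B : 'M[R]_n) (u : 'rV[R]_n) : B^T = B ->
  (forall v, 0 <= qform B v) -> qform B u = 0 -> u *m B = 0.
Proof.
move=> Bsym Bpos Bu; set v := u *m B; apply: qform1_eq0.
set N := qform 1%:M v; set Q := qform B v.
have N0 : 0 <= N by exact: qform1_ge0.
have Q0 : 0 <= Q by exact: Bpos.
have Q1 : 0 < Q + 1 by lra.
(* The parabola [s^2 Q - 2 s N] is least at [N / Q]; the added 1 covers [Q = 0] and still leaves the
   negative value [- (Q + 2) N^2 / (Q + 1)^2] when [N] is nonzero. *)
pose s := N / (Q + 1).
have expand : qform B (u - s *: v) = s ^+ 2 * Q - 2 * s * N.
  have uBv : (u *m B *m v^T) 0 0 = N by rewrite /N /qform mulmx1.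
  have vBu : (v *m B *m u^T) 0 0 = N.
    have BuT : B *m u^T = v^T by rewrite trmx_mul Bsym.
    by rewrite -mulmxA BuT /N /qform mulmx1.
  have uBu : (u *m B *m u^T) 0 0 = 0 by [].
  have vBv : (v *m B *m v^T) 0 0 = Q by [].
  clearbody v; rewrite /qform [(u - _)^T]linearB /= [(s *: v)^T]linearZ /=.
  rewrite !mulmxBl !mulmxBr.
  rewrite -!scalemxAl -!scalemxAr !scalerA.
  move: (_ *m _) (_ *m _) (_ *m _) (_ *m _) uBv vBu uBu vBv => M1 M2 M3 M4.
  by move=> m1 m2 m3 m4; rewrite !mxE m1 m2 m3 m4; ring.
have := Bpos (u - s *: v); rewrite expand /s => ineq.
have {}ineq : 0 <= - (Q + 2) * N ^+ 2.
  have -> : - (Q + 2) * N ^+ 2 =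
      (Q + 1) ^+ 2 * ((N / (Q + 1)) ^+ 2 * Q - 2 * (N / (Q + 1)) * N).
    by field; rewrite gt_eqF.
  by rewrite mulr_ge0// sqr_ge0.
by apply/eqP; rewrite -sqrf_eq0 eq_le sqr_ge0 andbT; nra.
Qed.

Lemma qformB n (A B : 'M[R]_n) u : qform (A - B) u = qform A u - qform B u.
Proof. by rewrite /qform mulmxBr mulmxBl !mxE. Qed.

Lemma qform_scalar n k (u : 'rV[R]_n) : qform k%:M u = k * qform 1%:M u.
Proof. by rewrite /qform mulmx1 mul_mx_scalar -scalemxAl mxE. Qed.

(** By homogeneity a minimiser on the compact unit sphere controls every [v]; the positive size
    makes the sphere nonempty. *)
Lemma qform_min n (A : 'M[R]_n.+1) :
  exists2 u, qform 1%:M u = 1 & forall v, qform A u * qform 1%:M v <= qform A v.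
Proof.
have S0 : [set u : 'rV[R]_n.+1 | qform 1%:M u = 1] !=set0.
  exists (delta_mx 0 0); rewrite /= qform1E (bigD1 ord0)//= mxE !eqxx expr1n.
  rewrite big1 ?addr0// => j j0.
  by rewrite mxE eqxx (negbTE j0) expr0n.
have [|u] := @compact_EVT_min _ _ (qform A) _ S0 (@compact_sphere _).
  by apply: continuous_subspaceT => ?; exact: continuous_qform.
rewrite inE/= => u1 umin; exists u => // v.
have [v0|vN0] := eqVneq (qform 1%:M v) 0.
  by rewrite (qform1_eq0 v0) /qform !mul0mx !mxE mulr0.
have vgt0 : 0 < qform 1%:M v by rewrite lt0r vN0 qform1_ge0.
have : qform 1%:M ((Num.sqrt (qform 1%:M v))^-1 *: v) = 1.
  by rewrite qformZ exprVn sqr_sqrtr ?ltW// mulVf.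
move=> /mem_set /umin; rewrite qformZ exprVn sqr_sqrtr ?qform1_ge0//.
by rewrite ler_pdivlMl// mulrC.
Qed.

(* A minimiser of [qform A] on the unit sphere is an eigenvector of [A], by
   [psd_qform_eq0] applied to [A] minus its minimal value. *)
Lemma lambda_min_qform n (A : 'M[R]_n) u : A^T = A ->
  lambda_min A * qform 1%:M u <= qform A u.
Proof.
case: n => [|n] in A u * => Asym; first by rewrite !qformE !big_ord0 mulr0.
have [u0 u01 u0min] := qform_min A; set m := qform A u0 in u0min.
apply: le_trans (u0min u); apply: ler_wpM2r; first exact: qform1_ge0.
apply: ge_inf; last first.
  rewrite /=; apply/eigenvalueP; exists u0; last first.
    by apply/eqP => u00; move: u01; rewrite u00 qform1E big1 ?mxE => [/eqP|*];
      rewrite ?mxE ?expr0n// eq_sym oner_eq0.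
  apply/eqP; rewrite -subr_eq0 -mul_mx_scalar -mulmxBr; apply/eqP.
  apply: psd_qform_eq0 => [|v|].
  - by rewrite linearB/= Asym tr_scalar_mx.
  - by rewrite qformB qform_scalar subr_ge0.
  - by rewrite qformB qform_scalar u01 mulr1 subrr.
(* The infimum is below its member [m] once the eigenvalues have a lower bound. An eigenvector [v]
   for [r] gives [r |v|^2 = qform A v >= m |v|^2], so [m] is one. *)
exists m => r /= /eigenvalueP[v vA vN0].
have vgt0 : 0 < qform 1%:M v.
  rewrite lt0r qform1_ge0 andbT; apply: contra_neq vN0; exact: qform1_eq0.
rewrite -(ler_pM2r vgt0) (le_trans (u0min v))//.
by rewrite /qform vA mulmx1 -scalemxAl mxE.
Qed.

Lemma lambda_min_unitmx n (A : 'M[R]_n) :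
  A^T = A -> 0 < lambda_min A -> A \in unitmx.
Proof.
move=> Asym Apos; rewrite -row_free_unit; apply/inj_row_free => u uA.
apply: qform1_eq0; apply/eqP; rewrite eq_le qform1_ge0 andbT.
rewrite -(pmulr_rle0 _ Apos) (le_trans (lambda_min_qform u Asym))//.
by rewrite /qform uA mul0mx mxE.
Qed.

Lemma cauchy_schwarz_sum n (u v : 'I_n -> R) :
  (\sum_i u i * v i) ^+ 2 <= (\sum_i u i ^+ 2) * (\sum_i v i ^+ 2).
Proof.
set D := \sum_i u i * v i; set U := \sum_i u i ^+ 2; set V := \sum_i v i ^+ 2.
have V0 : 0 <= V by apply: sumr_ge0 => i _; rewrite sqr_ge0.
have [V00|VN0] := eqVneq V 0.
  have v0 i : v i = 0.
    apply/eqP; rewrite -sqrf_eq0; move/eqP: V00.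
    rewrite psumr_eq0; last by move=> *; rewrite sqr_ge0.
    by move=> /allP/(_ i); apply; rewrite mem_index_enum.
  by rewrite V00 mulr0 /D big1 ?expr0n// => i _; rewrite v0 mulr0.
have Vgt0 : 0 < V by rewrite lt0r VN0.
(* Multiplied by [V], the defect [U V - D^2] becomes the sum of squares of the entries of
   [V u - D v]. *)
rewrite -subr_ge0 -(pmulr_rge0 _ Vgt0).
have -> : V * (U * V - D ^+ 2) = \sum_i (V * u i - D * v i) ^+ 2.
  under eq_bigr do rewrite sqrrB !exprMn.
  rewrite big_split sumrB /= -!mulr_sumr -/U -/V.
  under eq_bigr do rewrite mulrACA -mulrnAr.
  by rewrite -mulr_sumr sumrMnl -/D; ring.
by apply: sumr_ge0 => i _; rewrite sqr_ge0.
Qed.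

(** With [x = invmx A *m v], the eigenvalue bound and Cauchy-Schwarz give
    [c |x|^2 <= <x, v> <= |x| |v|]; the form with squares avoids square roots. *)
Lemma lambda_min_invmx n (A : 'M[R]_n) (v : 'cV[R]_n) c :
  A^T = A -> 0 < c -> c <= lambda_min A ->
  c ^+ 2 * (\sum_i (invmx A *m v) i 0 ^+ 2) <= \sum_i v i 0 ^+ 2.
Proof.
move=> Asym c0 cA; have Aunit := lambda_min_unitmx Asym (lt_le_trans c0 cA).
set x := invmx A *m v.
have xE : qform 1%:M x^T = \sum_i x i 0 ^+ 2.
  by rewrite qform1E; apply: eq_bigr => i _; rewrite mxE.
have AxE : qform A x^T = \sum_i x i 0 * v i 0.
  rewrite /qform trmxK -mulmxA mulKVmx// mxE.
  by apply: eq_bigr => i _; rewrite mxE.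
have := lambda_min_qform x^T Asym; rewrite xE AxE => ray.
have := cauchy_schwarz_sum (fun i => x i 0) (fun i => v i 0).
set X := \sum_i x i 0 ^+ 2 in xE ray *; set V := \sum_i v i 0 ^+ 2.
set D := \sum_i _ in ray *; move=> cs.
have X0 : 0 <= X by rewrite -xE qform1_ge0.
have [X00|XN0] := eqVneq X 0.
  by rewrite X00 mulr0 sumr_ge0// => i _; rewrite sqr_ge0.
have Xgt0 : 0 < X by rewrite lt0r XN0.
have cXD : c * X <= D by apply: le_trans ray; rewrite ler_pM2r.
rewrite -(ler_pM2r Xgt0) [V * X]mulrC; apply: le_trans cs.
rewrite (_ : _ * X = (c * X) ^+ 2); last by ring.
by rewrite ler_pXn2r// nnegrE ?mulr_ge0 ?(le_trans _ cXD) ?mulr_ge0// ltW.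
Qed.

End rayleigh.

(** * Restricted measures, image laws and independence *)

Section finite_law.
Set Implicit Arguments.
Unset Strict Implicit.
Local Open Scope ereal_scope.
Context d d' (T : measurableType d) (T' : measurableType d') (R : realType).
Variables (mu : {finite_measure set T -> \bar R}) (X : {mfun T >-> T'}).

Definition law := pushforward mu X.

Let law0 : law set0 = 0. Proof. exact: measure0. Qed.

Let law_ge0 A : 0 <= law A. Proof. exact: measure_ge0. Qed.

Let law_sigma_additive : semi_sigma_additive law.
Proof. exact: measure_semi_sigma_additive. Qed.

HB.instance Definition _ := isMeasure.Build _ _ _ law
  law0 law_ge0 law_sigma_additive.

Let law_fin : fin_num_fun law.
Proof.
by move=> A mA; apply: fin_num_measure; rewrite -[X in measurable X]setTI;
  exact: measurable_funPT.
Qed.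

HB.instance Definition _ := Measure_isFinite.Build _ _ _ law law_fin.

End finite_law.

Section restriction.
Set Implicit Arguments.
Unset Strict Implicit.
Local Open Scope ereal_scope.
Context d (T : measurableType d) (R : realType).
Variables (mu : {measure set T -> \bar R}) (D : set T) (mD : measurable D).

Let mrestrC : mrestr mu mD (~` D) = 0.
Proof. by rewrite /mrestr setICl measure0. Qed.

(** The complement of [D] is null for the restricted measure, which agrees with [mu] inside [D].
    Conditioning on an event thus becomes integration over the whole space for another finite
    measure. *)
Lemma ge0_integral_mrestr (f : T -> \bar R) : measurable_fun setT f ->
  (forall x, 0 <= f x) -> \int[mrestr mu mD]_x f x = \int[mu]_(x in D) f x.
Proof.
move=> mf f0; rewrite (@ge0_negligible_integral _ _ _ _ setT (~` D))//.
- rewrite setTD setCK; apply: eq_measure_integral => A mA AD.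
  by rewrite /= /mrestr setIidl.
- exact: measurableC.
Qed.

Lemma integrable_mrestr (f : T -> \bar R) : measurable_fun setT f ->
  mu.-integrable D f -> (mrestr mu mD).-integrable setT f.
Proof.
move=> mf /integrableP[_ foo]; apply/integrableP; split => //.
by rewrite ge0_integral_mrestr//; exact: measurableT_comp.
Qed.

Lemma integral_mrestr (f : T -> \bar R) : measurable_fun setT f ->
  mu.-integrable D f -> \int[mrestr mu mD]_x f x = \int[mu]_(x in D) f x.
Proof.
move=> mf /(integrable_mrestr mf) intf.
rewrite (@negligible_integral _ _ _ _ setT (~` D))//.
- rewrite setTD setCK; apply: eq_measure_integral => A mA AD.
  by rewrite /= /mrestr setIidl.
- exact: measurableC.
Qed.

Lemma integral_mscale (k : {nonneg R}) (f : T -> \bar R) :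
  mu.-integrable setT f ->
  \int[mscale k mu]_x f x = k%:num%:E * \int[mu]_x f x.
Proof.
move=> intf; have mf := measurable_int _ intf.
rewrite [LHS]integralE [in RHS]integralE.
rewrite (ge0_integral_mscale _ _ _ (measurable_funepos mf))//.
rewrite (ge0_integral_mscale _ _ _ (measurable_funeneg mf))//.
by rewrite (muleBr _ (integrable_add_def measurableT intf)).
Qed.

End restriction.

Section independent_product.
Set Implicit Arguments.
Unset Strict Implicit.
Local Open Scope ereal_scope.
Context d (T : measurableType d) (R : realType).

(* The product rule is that of independence under [mu / mu setT], cleared of
   denominators. *)
Lemma integral_indep_mul_eq0 (mu : {finite_measure set T -> \bar R})
    (U V : {mfun T >-> R}) :
  (forall A B, measurable A -> measurable B ->
     mu (U @^-1` A `&` V @^-1` B) * mu setT = mu (U @^-1` A) * mu (V @^-1` B)) ->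
  mu.-integrable setT (EFin \o U) -> mu.-integrable setT (EFin \o V) ->
  mu.-integrable setT (EFin \o (U \* V)%R) ->
  \int[mu]_x (U x)%:E = 0 -> \int[mu]_x (U x * V x)%:E = 0.
Proof.
move=> indep intU intV intUV U0.
have [T0|TN0] := eqVneq (mu setT) 0.
  by apply: null_set_integral => //; exact: measurable_int intUV.
pose UV : {mfun T >-> (R * R)%type} := HB.pack (fun x => (U x, V x))
  (isMeasurableFun.Build _ _ _ _ _
    (measurable_fun_pair (@measurable_funPT _ _ _ _ U) (@measurable_funPT _ _ _ _ V))).
pose f (z : R * R) : \bar R := (z.1 * z.2)%:E.
have mf : measurable_fun setT f.
  by apply/measurable_EFinP; apply: measurable_funM.
have pfin : mu setT \is a fin_num by exact: fin_num_measure.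
have p0 : (0 <= fine (mu setT))%R by exact: fine_ge0.
pose p : {nonneg R} := NngNum p0.
(* On rectangles this is the product rule; uniqueness of the product measure extends it to all
   measurable sets. *)
have prodE X : measurable X ->
    (law mu U \x law mu V) X = mscale p (law mu UV) X.
  apply: product_measure_unique => A B mA mB.
  rewrite -indep// muleC -[in RHS](fineK pfin).
  by rewrite -[LHS]/((fine (mu setT))%:E * mu (U @^-1` A `&` V @^-1` B)).
have intf : (law mu UV).-integrable setT f by exact: integrable_pushforward.
have cV : \int[law mu V]_y `|y%:E| < +oo.
  rewrite ge0_integral_pushforward//; last exact/measurableT_comp.
  by move/integrableP : intV => [].
(* By Tonelli, the integral of [|x y|] is the product of the integrals of [|x|] and [|y|]. *)
have intfp : (law mu U \x law mu V).-integrable setT f.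
  apply/integrable12ltyP => //.
  under eq_integral => x _.
    under eq_integral do rewrite /f /= normrM EFinM.
    rewrite ge0_integralZl//; last exact/measurableT_comp.
    over.
  rewrite /= ge0_integralZr//; [|exact/measurableT_comp|exact: integral_ge0].
  rewrite lte_mul_pinfty//; first exact: integral_ge0.
  rewrite ge0_integral_pushforward//; last exact/measurableT_comp.
  rewrite ge0_fin_numE; last by apply: integral_ge0 => x _ /=; rewrite lee_fin.
  by move/integrableP : intU => [].
have prod0 : \int[law mu U \x law mu V]_z f z = 0.
  have intid (W : {mfun T >-> R}) : mu.-integrable setT (EFin \o W) ->
      (law mu W).-integrable setT EFin.
    by move=> intW; exact: integrable_pushforward.
  have /fineK cE := integrable_fin_num measurableT (intid _ intV).
  rewrite -integral12_prod_meas1//.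
  under eq_integral => x _.
    rewrite /fubini_F /f; under eq_integral do rewrite /= EFinM.
    rewrite (integralZl measurableT (intid _ intV)) -cE.
    over.
  rewrite /= (integralZr measurableT (intid _ intU)).
  by rewrite integral_pushforward// U0 mul0e.
(* The total mass times the desired integral is the integral of [f] against the product law; the
   mass being nonzero here, it can be cancelled. *)
have : p%:num%:E * \int[mu]_x (U x * V x)%:E = 0.
  rewrite -prod0 (eq_measure_integral (mscale p (law mu UV))); last first.
    by move=> A mA _; exact: prodE.
  by rewrite integral_mscale// integral_pushforward.
by rewrite /= fineK// => /eqP; rewrite mule_eq0 (negbTE TN0) => /eqP.
Qed.

End independent_product.

(** * Measurability of the features *)

Section path_measurability.
Set Implicit Arguments.
Unset Strict Implicit.
Context d (T : measurableType d) (R : realType) (d0 d1 : nat).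
Variables (phi : d0.-tuple R -> 'cV[R]_d1) (w : nat -> nat -> R).
Hypothesis mphi : forall i, measurable_fun setT (fun v => phi v i 0).
Variables (X : nat -> T -> d0.-tuple R) (A : nat -> T -> bool).

Lemma measurable_natr_bool (b : T -> bool) :
  measurable_fun setT b -> measurable_fun setT (fun om => (b om)%:R : R).
Proof.
move=> mb; rewrite (_ : (fun _ => _) = fun om => if b om then 1 else 0).
  exact: measurable_fun_ifT.
by apply/funext => om; case: (b om).
Qed.

Lemma measurable_sum_nat (m n : nat) (f : nat -> T -> R) :
  (forall s, (m <= s < n)%N -> measurable_fun setT (f s)) ->
  measurable_fun setT (fun om => \sum_(m <= s < n) f s om).
Proof.
move=> mf; under eq_fun do rewrite big_nat big_mkcond.
by apply: measurable_sum => s; have [sn|_] := boolP (m <= s < n)%N;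
  [exact: mf|exact: measurable_cst].
Qed.

Lemma measurable_kappa t : (forall s, (0 < s < t)%N -> measurable_fun setT (A s)) ->
  measurable_fun setT (fun om => kappa w (A ^~ om) t).
Proof.
move=> mA; apply: measurable_sum_nat => s /mA mAs.
by apply: measurable_funM => //; exact: measurable_natr_bool.
Qed.

(** The space [T] is abstract so that the lemma applies to [Omega] and also to its sub-sigma-algebra
    of past events. Hence measurability is asked only of [X t] and of the actions up to [t]. *)
Lemma measurable_zvec t j : (0 < t)%N -> measurable_fun setT (X t) ->
  (forall s, (0 < s <= t)%N -> measurable_fun setT (A s)) ->
  measurable_fun setT (fun om => zvec phi w (X ^~ om) (A ^~ om) t j 0).
Proof.
move=> t0 mX mA.
have mAt : measurable_fun setT (fun om => (A t om)%:R : R).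
  by apply/measurable_natr_bool/mA; rewrite t0/=.
have mphiX i : measurable_fun setT (fun om => phi (X t om) i 0).
  exact: measurableT_comp (mphi i) mX.
rewrite /zvec /stack; case: (split_ordP j) => k ->.
  under eq_fun do rewrite col_mxEu.
  case: (split_ordP k) => l ->.
    under eq_fun do rewrite col_mxEu mxE.
    by apply: measurable_funM => //; exact: measurable_funB.
  under eq_fun do rewrite col_mxEd mxE.
  exact: measurable_funM.
rewrite (_ : (fun _ => _) = fun om => kappa w (A ^~ om) t); last first.
  by apply/funext => om; rewrite col_mxEd (ord1 k) mxE mulr1n.
by apply: measurable_kappa => s /andP[s0 /ltnW st]; apply: mA; rewrite s0 st.
Qed.

End path_measurability.

(** * Algebra of the features and of least squares *)

Section path_algebra.
Set Implicit Arguments.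
Unset Strict Implicit.
Context (R : realType) (d0 d1 : nat).
Variables (phi : d0.-tuple R -> 'cV[R]_d1) (w : nat -> nat -> R).

Lemma mean_rewardE b0 b1 g x a t : mean_reward phi w b0 b1 g x a t =
  \sum_j zvec phi w x a t j 0 * stack b0 b1 g j 0.
Proof.
transitivity (((zvec phi w x a t)^T *m stack b0 b1 g) 0 0); last first.
  by rewrite mxE; apply: eq_bigr => j _; rewrite mxE.
rewrite /mean_reward /zvec /stack !tr_col_mx !mul_row_col !linearZ/= -!scalemxAl.
by rewrite tr_scalar_mx -scalar_mxM [RHS]mxE [X in _ = X + _]mxE
  [in RHS]mxE [X in _ = _ + X + _]mxE [X in _ = _ + X]mxE /dot eqxx mulr1n.
Qed.

Lemma eq_zvec x a a' t : (forall s, (s <= t)%N -> a s = a' s) ->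
  zvec phi w x a t = zvec phi w x a' t.
Proof.
move=> aa'; rewrite /zvec aa'//; congr (stack _ _ _).
rewrite /kappa big_nat [RHS]big_nat; apply: eq_bigr => s /andP[_ st].
by rewrite aa'// ltnW.
Qed.

Lemma ler_norm_kappa a t L : \sum_(1 <= s < t) `|w t s| <= L ->
  `|kappa w a t| <= L.
Proof.
apply: le_trans; apply: le_trans (ler_norm_sum _ _ _) _.
apply: ler_sum => s _; rewrite normrM ler_piMr//.
by rewrite normr_nat; case: (a s).
Qed.

Lemma ler_norm_zvec x a t L j : `|phi (x t)| <= L ->
  \sum_(1 <= s < t) `|w t s| <= L -> `|zvec phi w x a t j 0| <= L.
Proof.
move=> phiL wL.
have phijL i : `|phi (x t) i 0| <= L.
  by move: phiL; rewrite [X in X <= _]mx_normrE => /bigmax_leP[_ /(_ (i, 0))]; apply.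
rewrite /zvec /stack; case: (split_ordP j) => k ->.
  rewrite col_mxEu; case: (split_ordP k) => l ->;
    rewrite ?col_mxEu ?col_mxEd mxE normrM; apply: le_trans (phijL l);
    by apply: ler_piMl => //; case: (a t); rewrite ?subrr ?subr0 ?normr0 ?normr1.
by rewrite col_mxEd mxE (ord1 k) eqxx mulr1n; exact: ler_norm_kappa.
Qed.

Lemma tr_gram n (z : nat -> 'cV[R]_(n + n + 1)) t : (gram z t)^T = gram z t.
Proof.
rewrite /gram linearZ/= linear_sum/=; congr (_ *: _); apply: eq_bigr => s _.
by rewrite trmx_mul trmxK.
Qed.

(** Write [th] as [invmx G *m (G *m th)] with [G] the Gram matrix: each [z_s z_s^T th] is [z_s]
    scaled by the prediction at [s], so only residuals remain. *)
Lemma theta_hatB n (z : nat -> 'cV[R]_(n + n + 1)) (y : nat -> R) th t :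
  gram z t \in unitmx -> theta_hat z y t - th =
  invmx (gram z t) *m
    (t%:R^-1 *: \sum_(1 <= s < t.+1) (y s - \sum_j z s j 0 * th j 0) *: z s).
Proof.
move=> Gunit; rewrite /theta_hat -[th in LHS](mulKmx Gunit) -mulmxBr.
congr (_ *m _); rewrite /gram -scalemxAl -scalerBr mulmx_suml -sumrB.
congr (_ *: _); apply: eq_bigr => s _; rewrite scalerBl; congr (_ - _).
rewrite -mulmxA [(z s)^T *m th]mx11_scalar mul_mx_scalar; congr (_ *: _).
by rewrite mxE; apply: eq_bigr => j _; rewrite mxE.
Qed.

End path_algebra.

(** * Measurability of matrix inversion and norm *)

Section measurable_matrix.
Set Implicit Arguments.
Unset Strict Implicit.
Context d (T : measurableType d) (R : realType).

(** Inversion is continuous only away from 0, so the line is cut into [{0}] and its open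
    complement. *)
Lemma measurable_invr : measurable_fun setT (fun r : R => r^-1).
Proof.
rewrite -(setUv [set (0 : R)]); apply/measurable_funU => //.
  exact: measurableC.
split; first exact: measurable_fun_set1.
apply: open_continuous_measurable_fun; first exact/closed_openC/closed_eq.
by move=> r; rewrite inE/= => /eqP r0; exact: inv_continuous.
Qed.

Lemma measurable_det n (M : T -> 'M[R]_n) :
  (forall i j, measurable_fun setT (fun om => M om i j)) ->
  measurable_fun setT (fun om => \det (M om)).
Proof.
move=> mM; apply: measurable_sum => s; apply: measurable_funM => //.
by apply: measurable_prod => i _; exact: mM.
Qed.

(** A measurable test on the determinant separates the adjugate formula from the singular case,
    where [invmx] returns its argument. *)
Lemma measurable_invmx n (M : T -> 'M[R]_n) i j :
  (forall i j, measurable_fun setT (fun om => M om i j)) ->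
  measurable_fun setT (fun om => invmx (M om) i j).
Proof.
move=> mM; rewrite (_ : (fun _ => _) = fun om => if \det (M om) == 0
    then M om i j else (\det (M om))^-1 * cofactor (M om) j i).
  apply: measurable_fun_ifT => //.
    by apply: measurable_fun_eqr => //; exact: measurable_det.
  apply: measurable_funM.
    exact: measurableT_comp measurable_invr (measurable_det mM).
  apply: measurable_funM => //; apply: measurable_det => k l.
  by under eq_fun do rewrite !mxE; exact: mM.
apply/funext => om; rewrite /invmx unitmxE unitfE.
by case: eqP => _ //=; rewrite !mxE.
Qed.

Lemma measurable_mx_norm m n (M : T -> 'M[R]_(m, n)) :
  (forall i j, measurable_fun setT (fun om => M om i j)) ->
  measurable_fun setT (fun om => `|M om|).
Proof.
move=> mM; rewrite (_ : (fun _ => _) = fun om =>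
    \big[Num.max/0]_ij `|M om ij.1 ij.2|); last first.
  by apply/funext => om; exact: mx_normrE.
elim: index_enum => [|ij r IHr].
  by under eq_fun do rewrite big_nil; exact: measurable_cst.
under eq_fun do rewrite big_cons; apply: measurable_maxr => //.
exact: measurableT_comp.
Qed.

End measurable_matrix.

(** * Almost sure inclusion, Markov's inequality and truncation *)

Section measure_bounds.
Set Implicit Arguments.
Unset Strict Implicit.
Context d (T : measurableType d) (R : realType) (P : probability T R).

Lemma ae_le_measure (A B : set T) : measurable A -> measurable B ->
  {ae P, forall om, A om -> B om} -> (P A <= P B)%E.
Proof.
move=> mA mB [N [mN N0 AB]].
have BN : measurable (B `|` N) by exact: measurableU.
apply: (@le_trans _ _ (P (B `|` N))).
  apply: le_measure; rewrite ?inE// => om Aom.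
  have [Bom|Bom] := pselect (B om); [by left|right].
  by apply: AB => /= /(_ Aom).
by rewrite measureU0.
Qed.

Lemma markov_ge0 (Q : T -> R) c : 0 < c -> measurable_fun setT Q ->
  (forall om, 0 <= Q om) ->
  (c%:E * P [set om | (c <= Q om)%R] <= \int[P]_om (Q om)%:E)%E.
Proof.
move=> c0 mQ Q0.
have := @le_integral_comp_abse _ _ _ P _ measurableT (EFin \o Q) c idfun
  (@measurable_id _ _ _) (fun _ => id) (fun _ _ _ _ => id).
rewrite setTI /= => /(_ _ c0) ineq.
have -> : [set om | c <= Q om] = [set om | (c%:E <= `|(Q om)%:E|)%E].
  by apply/seteqP; split => om /=; rewrite lee_fin ger0_norm.
apply: le_trans (ineq _) _; first exact/measurable_EFinP.
by under eq_integral do rewrite ger0_norm//.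
Qed.

End measure_bounds.

Section clip.
Set Implicit Arguments.
Unset Strict Implicit.
Context (R : realType).

Definition clip (L r : R) := Num.max (- L) (Num.min r L).

Lemma clip_id L r : `|r| <= L -> clip L r = r.
Proof.
by rewrite ler_norml => /andP[Lr rL]; rewrite /clip (min_idPl rL) (max_idPr Lr).
Qed.

Lemma ler_norm_clip L r : 0 <= L -> `|clip L r| <= L.
Proof.
by move=> L0; rewrite ler_norml /clip le_max lexx/= ge_max ge_min lexx orbT andbT; lra.
Qed.

Lemma measurable_clip d (T : measurableType d) L (f : T -> R) :
  measurable_fun setT f -> measurable_fun setT (fun om => clip L (f om)).
Proof.
by move=> mf; apply: measurable_maxr => //; exact: measurable_minr.
Qed.

End clip.

(** * Second moments and integrability *)

Section second_moments.
Set Implicit Arguments.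
Unset Strict Implicit.
Context d (Omega : measurableType d) (R : realType) (P : probability Omega R).

(** From [1 + r^2 / 2 <= expR r] at [r = |X|] one gets [X^2 <= 2 expR |X| <= 2 (expR X + expR (-
    X))], and the moment generating function is bounded at 1 and -1; hence the factor 4. *)
Lemma subgaussian_second_moment sigma (X : Omega -> R) :
  measurable_fun setT X -> subgaussian P sigma X ->
  (\int[P]_om (X om ^+ 2)%:E <= (4 * expR (sigma ^+ 2 / 2))%:E)%E.
Proof.
move=> mX sub.
have mexp k : measurable_fun setT (fun om => (expR (X om * k))%:E).
  apply/measurable_EFinP; apply: measurableT_comp => //.
  exact: measurable_funM.
have sub1 k : k ^+ 2 = 1 ->
    (\int[P]_om (expR (X om * k))%:E <= (expR (sigma ^+ 2 / 2))%:E)%E.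
  by move=> k1; have := sub k; rewrite /mmt_gen_fun unlock k1 mul1r.
apply: (@le_trans _ _
    (\int[P]_om (2%:E * ((expR (X om * 1))%:E + (expR (X om * -1))%:E)))%E).
  apply: ge0_le_integral => //.
  - by move=> om _; rewrite lee_fin sqr_ge0.
  - by apply/measurable_EFinP; exact: measurable_funX.
  - by apply: emeasurable_funM => //; exact: emeasurable_funD.
  move=> om _; rewrite -EFinD -EFinM lee_fin mulr1 mulrN1.
  have : X om ^+ 2 <= 2 * expR `|X om|.
    have := expR_ge1Dxn 1 (normr_ge0 (X om)); rewrite real_normK ?num_real//.
    by rewrite (_ : 2`! = 2)//; lra.
  move=> /le_trans; apply; rewrite ler_pM2l//.
  have [x0|x0] := lerP 0 (X om).
    by rewrite ger0_norm// lerDl expR_ge0.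
  by rewrite ltr0_norm// lerDr expR_ge0.
rewrite ge0_integralZl//; last 2 first.
- exact: emeasurable_funD.
- by move=> om _; rewrite -EFinD lee_fin addr_ge0// expR_ge0.
rewrite ge0_integralD//.
rewrite (_ : 4 * _ = 2 * (expR (sigma ^+ 2 / 2) + expR (sigma ^+ 2 / 2)))%R;
  last by ring.
rewrite EFinM lee_pmul2l// EFinD.
by apply: leeD; apply: sub1; rewrite ?sqrrN expr1n.
Qed.

Lemma integrable_sqr (X : Omega -> R) : measurable_fun setT X ->
  (\int[P]_om (X om ^+ 2)%:E < +oo)%E ->
  P.-integrable setT (fun om => (X om ^+ 2)%:E).
Proof.
move=> mX X2oo; apply/integrableP; split.
  by apply/measurable_EFinP; exact: measurable_funX.
by under eq_integral do rewrite gee0_abs ?lee_fin ?sqr_ge0//.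
Qed.

Lemma integrable_mul (X Y : Omega -> R) :
  measurable_fun setT X -> measurable_fun setT Y ->
  P.-integrable setT (fun om => (X om ^+ 2)%:E) ->
  P.-integrable setT (fun om => (Y om ^+ 2)%:E) ->
  P.-integrable setT (fun om => (X om * Y om)%:E).
Proof.
move=> mX mY intX intY; apply: le_integrable (integrableD measurableT intX intY) => //.
  by apply/measurable_EFinP; exact: measurable_funM.
move=> om _ /=; rewrite lee_fin normrM [X in _ <= X]ger0_norm ?addr_ge0 ?sqr_ge0//.
rewrite -[X in X + _]real_normK ?num_real// -[X in _ + X]real_normK ?num_real//.
by have := normr_ge0 (X om); have := normr_ge0 (Y om); nra.
Qed.

Lemma integrable_of_sqr (X : Omega -> R) : measurable_fun setT X ->
  P.-integrable setT (fun om => (X om ^+ 2)%:E) ->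
  P.-integrable setT (EFin \o X).
Proof.
move=> mX intX; rewrite (_ : EFin \o X = fun om => (X om * 1)%:E).
  apply: (@integrable_mul X (cst 1)) => //.
  rewrite (_ : (fun _ => _) = EFin \o cst 1).
    exact: finite_measure_integrable_cst.
  by apply/funext => om /=; rewrite expr1n.
by apply/funext => om /=; rewrite mulr1.
Qed.

Lemma clip_mul_second_moment L (Z Y : Omega -> R) : 0 <= L ->
  measurable_fun setT Z -> measurable_fun setT Y ->
  P.-integrable setT (fun om => (Y om ^+ 2)%:E) ->
  P.-integrable setT (fun om => ((clip L (Z om) * Y om) ^+ 2)%:E) /\
  (\int[P]_om ((clip L (Z om) * Y om) ^+ 2)%:E <=
   (L ^+ 2)%:E * \int[P]_om (Y om ^+ 2)%:E)%E.
Proof.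
move=> L0 mZ mY intY.
have mZY : measurable_fun setT (fun om => clip L (Z om) * Y om).
  by apply: measurable_funM => //; exact: measurable_clip.
have mZY2 : measurable_fun setT (fun om => ((clip L (Z om) * Y om) ^+ 2)%:E).
  by apply/measurable_EFinP; exact: measurable_funX.
have ineq om : (clip L (Z om) * Y om) ^+ 2 <= L ^+ 2 * Y om ^+ 2.
  rewrite exprMn ler_wpM2r ?sqr_ge0// -[X in X <= _]real_normK ?num_real//.
  by rewrite ler_pXn2r// ?nnegrE// ler_norm_clip.
have intLY := integrableZl measurableT (L ^+ 2) intY.
have intZY : P.-integrable setT (fun om => ((clip L (Z om) * Y om) ^+ 2)%:E).
  apply: le_integrable intLY => // om _; rewrite /= lee_fin.
  rewrite (ger0_norm (sqr_ge0 _)) ger0_norm ?ineq//.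
  by apply: mulr_ge0; exact: sqr_ge0.
split=> //; rewrite -integralZl//; apply: le_integral => //.
by move=> om _; rewrite -EFinM lee_fin.
Qed.

End second_moments.

(** * Noise, past events and orthogonality of the increments *)

Section noise.
Set Implicit Arguments.
Unset Strict Implicit.
Context {d : measure_display} {Omega : measurableType d} {R : realType}.
Variable P : probability Omega R.
Context {d0 d1 : nat}.
Variables (PX : probability (d0.-tuple R) R) (Pe : bool -> probability R R).
Variables (phi : d0.-tuple R -> 'cV[R]_d1) (w : nat -> nat -> R).
Variables (beta0 beta1 : 'cV[R]_d1) (gamma : R) (sigma : R) (sigma_ : bool -> R).
Variables (x : nat -> Omega -> d0.-tuple R) (a : nat -> Omega -> bool).
Variables (e : nat -> Omega -> R).
Hypothesis hmodel :
  bandit_model P PX Pe phi w beta0 beta1 gamma sigma sigma_ x a e.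

Local Notation past := (past phi w beta0 beta1 gamma x a e).
Local Notation reward := (reward phi w beta0 beta1 gamma x a e).
Local Notation mean := (mean phi w beta0 beta1 gamma x a).
Local Notation pastT t := (g_sigma_algebraType (past t)).

Let measurable_preimage d' (T' : measurableType d') (f : Omega -> T') B :
  measurable_fun setT f -> g_sigma_algebra_preimage f B -> measurable B.
Proof. by move=> mf [C mC <-]; exact: mf. Qed.

Lemma meanE t om : mean t om =
  \sum_j features phi w x a om t j 0 * stack beta0 beta1 gamma j 0.
Proof. exact: mean_rewardE. Qed.

Lemma measurable_features t j : (0 < t)%N ->
  measurable_fun setT (fun om => features phi w x a om t j 0).
Proof.
move=> t0; apply: measurable_zvec => //.
- exact: model_phi hmodel.
- exact: model_x hmodel t.
- by move=> s _; exact: model_a hmodel s.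
Qed.

Lemma measurable_mean t : (0 < t)%N -> measurable_fun setT (mean t).
Proof.
move=> t0; rewrite (_ : mean t = fun om =>
    \sum_j features phi w x a om t j 0 * stack beta0 beta1 gamma j 0).
  apply: measurable_sum => j; apply: measurable_funM => //.
  exact: measurable_features.
by apply/funext => om; exact: meanE.
Qed.

Lemma measurable_reward t : (0 < t)%N -> measurable_fun setT (reward t).
Proof.
move=> t0; apply: measurable_funD; first exact: measurable_mean.
exact: model_e hmodel t.
Qed.

Lemma past_measurable t : <<s past t>> `<=` measurable.
Proof.
apply: smallest_sub; first exact: sigma_algebra_measurable.
move=> B [|[s /= /andP[s0 _]] [[]|]]; apply: measurable_preimage.
- exact: model_x hmodel t.
- exact: model_x hmodel s.
- exact: model_a hmodel s.
- exact: measurable_reward.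
Qed.

Lemma measurable_fun_past t (f : Omega -> R) :
  measurable_fun [set: pastT t] f -> measurable_fun setT f.
Proof. by move=> mf _ B mB; apply: (@past_measurable t); exact: mf. Qed.

(** Here [s = t] is allowed: the generators of [past t] include the context at [t], but actions and
    rewards only before [t]. *)
Lemma past_x t s : (0 < s <= t)%N -> measurable_fun [set: pastT t] (x s).
Proof.
move=> /andP[s0]; rewrite leq_eqVlt => /predU1P[->|st] _ B mB.
  by apply: sub_sigma_algebra; left; exists B.
apply: sub_sigma_algebra; right; exists s; last by left; left; exists B.
by rewrite /= s0 -ltnS prednK// (leq_trans _ st).
Qed.

Lemma past_a t s : (0 < s < t)%N -> measurable_fun [set: pastT t] (a s).
Proof.
move=> /andP[s0 st] _ B mB.
apply: sub_sigma_algebra; right; exists s; last by left; right; exists B.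
by rewrite /= s0 -ltnS prednK// (leq_trans _ st).
Qed.

Lemma past_reward t s : (0 < s < t)%N -> measurable_fun [set: pastT t] (reward s).
Proof.
move=> /andP[s0 st] _ B mB.
apply: sub_sigma_algebra; right; exists s; last by right; exists B.
by rewrite /= s0 -ltnS prednK// (leq_trans _ st).
Qed.

Lemma past_features t s j : (0 < s < t)%N ->
  measurable_fun [set: pastT t] (fun om => features phi w x a om s j 0).
Proof.
move=> /andP[s0 st]; apply: (@measurable_zvec _ (pastT t)) => //.
- exact: model_phi hmodel.
- by apply: past_x; rewrite s0 ltnW.
- by move=> r /andP[r0 rs]; apply: past_a; rewrite r0 (leq_ltn_trans rs).
Qed.

(** The noise is not among the generators of the past; it is recovered as reward minus mean. *)
Lemma past_noise t s : (0 < s < t)%N -> measurable_fun [set: pastT t] (e s).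
Proof.
move=> st; rewrite (_ : e s = fun om => reward s om -
    \sum_j features phi w x a om s j 0 * stack beta0 beta1 gamma j 0).
  apply: measurable_funB; first exact: past_reward.
  by apply: measurable_sum => j; apply: measurable_funM => //; exact: past_features.
by apply/funext => om; rewrite -meanE /Defs.reward addrC addKr.
Qed.

(* Agrees with [features] on the event [a t = i] but, the action at time [t]
   being frozen, is measurable with respect to the past. *)
Definition features_at (i : bool) t j om :=
  zvec phi w (x ^~ om) [eta (a ^~ om) with t |-> i] t j 0.

Lemma features_atE i t j om : a t om = i ->
  features phi w x a om t j 0 = features_at i t j om.
Proof.
move=> ati; rewrite /features /features_at; congr (fun_of_matrix _ _ _).
by apply: eq_zvec => s _ /=; case: eqP => [->|].
Qed.

Lemma past_features_at i t j : (0 < t)%N ->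
  measurable_fun [set: pastT t] (features_at i t j).
Proof.
move=> t0; apply: (@measurable_zvec _ (pastT t) _ _ _ _ _ _ x
  (fun s om => if s == t then i else a s om)) => //.
- exact: model_phi hmodel.
- by apply: past_x; rewrite t0/=.
- move=> s /andP[s0 st]; have [_|sNt] := eqVneq s t; first exact: measurable_cst.
  by apply: past_a; rewrite s0 ltn_neqAle sNt.
Qed.

Definition noise_bound : R := 4 * expR (sigma ^+ 2 / 2).

Lemma noise_second_moment t : (0 < t)%N ->
  (\int[P]_om (e t om ^+ 2)%:E <= noise_bound%:E)%E.
Proof.
move=> t0; apply: (subgaussian_second_moment _ (model_subgaussian hmodel t0)).
exact: model_e hmodel t.
Qed.

Lemma integrable_noise_sqr t : (0 < t)%N ->
  P.-integrable setT (fun om => (e t om ^+ 2)%:E).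
Proof.
move=> t0; apply: integrable_sqr; first exact: model_e hmodel t.
by apply: le_lt_trans (noise_second_moment t0) _; rewrite ltry.
Qed.

Lemma integrable_noise t : (0 < t)%N -> P.-integrable setT (EFin \o e t).
Proof.
move=> t0; apply: integrable_of_sqr; last exact: integrable_noise_sqr.
exact: model_e hmodel t.
Qed.

Lemma measurable_action t i : measurable (a t @^-1` [set i]).
Proof. by rewrite -[X in measurable X]setTI; exact: (model_a hmodel t). Qed.

(** The event belongs to the sigma-algebra of the covariates, so reward and mean have the same
    integral over it. The mean is integrable as the difference of reward and noise. *)
Lemma noise_mean0 t i : (0 < t)%N ->
  (\int[P]_(om in a t @^-1` [set i]) (e t om)%:E = 0)%E.
Proof.
move=> t0; have [intr _ cond] := model_cond_mean hmodel t0.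
set D := a t @^-1` [set i].
have mD : measurable D by exact: measurable_action.
have intrD : P.-integrable D (EFin \o reward t) by exact: integrableS intr.
have inteD : P.-integrable D (EFin \o e t).
  by apply: integrableS (integrable_noise t0).
have intmD : P.-integrable D (EFin \o mean t).
  rewrite (_ : _ \o _ = (EFin \o reward t) \- (EFin \o e t))%E.
    exact: integrableB.
  by apply/funext => om; rewrite /= -EFinB /Defs.reward addrK.
have -> : (\int[P]_(om in D) (e t om)%:E =
    \int[P]_(om in D) ((reward t om)%:E - (mean t om)%:E))%E.
  apply: eq_integral => om _; rewrite -EFinB /Defs.reward; congr EFin.
  by rewrite addrC addKr.
rewrite integralB//= cond ?subee//.
  exact: (integrable_fin_num mD intmD).
by apply: sub_sigma_algebra; right; exists [set i] => //; rewrite setTI.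
Qed.

(** For [P] restricted to [D], of total mass [P D], the model's conditional independence is exactly
    the product rule of [integral_indep_mul_eq0]. *)
Lemma noise_orthogonal t i (W : Omega -> R) : (0 < t)%N ->
  measurable_fun [set: pastT t] W -> P.-integrable setT (EFin \o W) ->
  P.-integrable setT (fun om => (e t om * W om)%:E) ->
  (\int[P]_(om in a t @^-1` [set i]) (e t om * W om)%:E = 0)%E.
Proof.
move=> t0 pW intW inteW; set D := a t @^-1` [set i].
have mD : measurable D by exact: measurable_action.
have mW := measurable_fun_past pW.
have me := model_e hmodel t.
pose U : {mfun Omega >-> R} := HB.pack (e t) (isMeasurableFun.Build _ _ _ _ _ me).
pose V : {mfun Omega >-> R} := HB.pack W (isMeasurableFun.Build _ _ _ _ _ mW).
have restr (f : Omega -> R) : P.-integrable setT (EFin \o f) ->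
    (mrestr P mD).-integrable setT (EFin \o f) /\
    (\int[mrestr P mD]_om (f om)%:E = \int[P]_(om in D) (f om)%:E)%E.
  move=> intf; have mf := measurable_int _ intf.
  have intfD : P.-integrable D (EFin \o f) by exact: integrableS intf.
  by split; [exact: integrable_mrestr|exact: integral_mrestr].
have [inteW' <-] := restr _ inteW.
apply: (@integral_indep_mul_eq0 _ _ _ (mrestr P mD) U V) => //.
- move=> A B mA mB; rewrite /= /mrestr setTI -/D.
  have pB : <<s past t>> (W @^-1` B).
    by rewrite -[X in <<s _>> X]setTI; exact: pW.
  by rewrite !(setIC _ D) setIA; exact: (model_noise_indep hmodel t0 i mA pB).
- by case: (restr _ (integrable_noise t0)).
- by case: (restr _ intW).
- by case: (restr _ (integrable_noise t0)) => _ ->; exact: noise_mean0.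
Qed.

(* Almost surely the clipping does nothing; it makes the features bounded on
   the whole sample space. *)
Definition score L j t om : R :=
  \sum_(1 <= s < t.+1) clip L (features phi w x a om s j 0) * e s om.

Lemma past_score L j t : measurable_fun [set: pastT t.+1] (score L j t).
Proof.
apply: measurable_sum_nat => s /andP[s0 st]; apply: measurable_funM.
  by apply: measurable_clip; apply: past_features; rewrite s0.
by apply: past_noise; rewrite s0.
Qed.

Lemma measurable_score L j t : measurable_fun setT (score L j t).
Proof. exact: (measurable_fun_past (@past_score L j t)). Qed.

Lemma score_increment_orthogonal L j t : 0 <= L ->
  P.-integrable setT (fun om => (score L j t om ^+ 2)%:E) ->
  (\int[P]_om ((clip L (features phi w x a om t.+1 j 0) * e t.+1 om) *
     score L j t om)%:E = 0)%E.
Proof.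
move=> L0 intS2; have t0 : (0 < t.+1)%N by [].
have me := model_e hmodel t.+1.
have D i : (\int[P]_(om in a t.+1 @^-1` [set i])
    ((clip L (features phi w x a om t.+1 j 0) * e t.+1 om) * score L j t om)%:E = 0)%E.
  (* On the event [a_(t+1) = i] the integrand is [e_(t+1)] times [W], and [W] is measurable with
     respect to the past since its action is frozen. *)
  pose W om := clip L (features_at i t.+1 j om) * score L j t om.
  have pW : measurable_fun [set: pastT t.+1] W.
    apply: measurable_funM; last exact: past_score.
    by apply: measurable_clip; exact: past_features_at.
  have mW := measurable_fun_past pW.
  have [intW2 _] := clip_mul_second_moment L0
    (measurable_fun_past (past_features_at i j t0)) (@measurable_score L j t) intS2.
  have inteW : P.-integrable setT (fun om => (e t.+1 om * W om)%:E).
    by apply: integrable_mul => //; exact: integrable_noise_sqr.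
  rewrite -[RHS](noise_orthogonal i t0 pW (integrable_of_sqr mW intW2) inteW).
  apply: eq_integral => om /[!inE] /= ati; congr EFin.
  by rewrite (features_atE _ ati) /W mulrCA mulrA.
have mD i := measurable_action t.+1 i.
have -> : [set: Omega] = a t.+1 @^-1` [set true] `|` a t.+1 @^-1` [set false].
  by apply/seteqP; split => om //= _; case: (a t.+1 om); [left|right].
rewrite integral_setU ?D ?adde0//.
  apply: measurable_funTS; apply/measurable_EFinP; apply: measurable_funM.
    apply: measurable_funM => //; apply: measurable_clip.
    exact: measurable_features.
  exact: measurable_score.
by apply/disj_setPS => om [/= ->].
Qed.

(** Induction on [t]: the cross term vanishes and each increment adds at most [L^2 noise_bound].
    Integrability is carried along because the orthogonality of the next increment requires it. *)
Lemma score_second_moment L j t : 0 <= L ->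
  P.-integrable setT (fun om => (score L j t om ^+ 2)%:E) /\
  (\int[P]_om (score L j t om ^+ 2)%:E <=
   (t%:R * (L ^+ 2 * noise_bound))%:E)%E.
Proof.
move=> L0; elim: t => [|t [intS leS]].
  rewrite (_ : (fun _ => _) = cst 0%E).
    by split; [exact: integrable0|rewrite integral_cst// mul0e mul0r].
  by apply/funext => om; rewrite /score big_geq// expr0n.
pose S := score L j t.
pose X om := clip L (features phi w x a om t.+1 j 0) * e t.+1 om.
have mS : measurable_fun setT S by exact: measurable_score.
have mX : measurable_fun setT X.
  apply: measurable_funM; last exact: model_e hmodel t.+1.
  by apply: measurable_clip; exact: measurable_features.
have t0 : (0 < t.+1)%N by [].
have [intX leX] := clip_mul_second_moment L0 (measurable_features j t0)
  (model_e hmodel t.+1) (integrable_noise_sqr t0).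
have {}leX : (\int[P]_om (X om ^+ 2)%:E <= (L ^+ 2 * noise_bound)%:E)%E.
  apply: le_trans leX _; rewrite [X in (_ <= X)%E]EFinM.
  apply: lee_wpmul2l; first by rewrite lee_fin sqr_ge0.
  exact: noise_second_moment.
have intXS : P.-integrable setT (fun om => (X om * S om)%:E).
  exact: integrable_mul.
have int2XS := integrableZl measurableT 2 intXS.
have expand : (fun om => (score L j t.+1 om ^+ 2)%:E) =
    (fun om => (S om ^+ 2)%:E + (2%:E * (X om * S om)%:E + (X om ^+ 2)%:E))%E.
  apply/funext => om; rewrite /score big_nat_recr//= -/(score L j t om) -/(X om).
  by rewrite -/(S om) -EFinM -!EFinD; congr EFin; ring.
have intD := integrableD measurableT int2XS intX.
rewrite expand; split; first exact: integrableD.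
rewrite integralD// integralD// integralZl// score_increment_orthogonal//.
rewrite mule0 add0e -natr1 mulrDl mul1r EFinD.
exact: leeD.
Qed.

(** * Deviation of the estimator *)

Local Notation estimator := (estimator phi w beta0 beta1 gamma x a e).
Local Notation theta := (stack beta0 beta1 gamma).

(** The squared Euclidean norm of [sum_s e_s z_s], with truncated features. *)
Definition total_score L t om : R := \sum_j score L j t om ^+ 2.

Lemma total_score_ge0 L t om : 0 <= total_score L t om.
Proof. by apply: sumr_ge0 => j _; rewrite sqr_ge0. Qed.

Lemma measurable_total_score L t : measurable_fun setT (total_score L t).
Proof.
by apply: measurable_sum => j; apply: measurable_funX; exact: measurable_score.
Qed.

Lemma total_score_mean L t : 0 <= L ->
  (\int[P]_om (total_score L t om)%:E <=
   ((d1 + d1 + 1)%:R * (t%:R * (L ^+ 2 * noise_bound)))%:E)%E.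
Proof.
move=> L0; under eq_integral do rewrite /total_score -sumEFin.
rewrite ge0_integral_sum//; last 2 first.
- move=> j; apply/measurable_EFinP/measurable_funX; exact: measurable_score.
- by move=> j om _; rewrite lee_fin sqr_ge0.
apply: (@le_trans _ _
    (\sum_(j < d1 + d1 + 1) (t%:R * (L ^+ 2 * noise_bound))%:E)%E).
  by apply: lee_sum => j _; have [] := score_second_moment j t L0.
by rewrite sumEFin lee_fin sumr_const card_ord -[leLHS]mulr_natl.
Qed.

Lemma measurable_estimator t i :
  measurable_fun setT (fun om => estimator t om i 0).
Proof.
have mG k l : measurable_fun setT (fun om => gram (features phi w x a om) t k l).
  rewrite (_ : (fun _ => _) = fun om => t%:R^-1 *
    \sum_(1 <= s < t.+1) features phi w x a om s k 0 * features phi w x a om s l 0).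
    apply: measurable_funM => //; apply: measurable_sum_nat => s /andP[s0 _].
    by apply: measurable_funM; exact: measurable_features.
  apply/funext => om; rewrite mxE summxE; congr (_ * _); apply: eq_bigr => s _.
  by rewrite mxE big_ord1 [_^T _ _]mxE.
rewrite (_ : (fun _ => _) = fun om =>
  \sum_k invmx (gram (features phi w x a om) t) i k *
  (t%:R^-1 * \sum_(1 <= s < t.+1) reward s om * features phi w x a om s k 0)).
  apply: measurable_sum => k; apply: measurable_funM.
    exact: (measurable_invmx (M := fun om => gram (features phi w x a om) t)).
  apply: measurable_funM => //; apply: measurable_sum_nat => s /andP[s0 _].
  by apply: measurable_funM; [exact: measurable_reward|exact: measurable_features].
apply/funext => om; rewrite mxE; apply: eq_bigr => k _; congr (_ * _).
by rewrite mxE summxE; congr (_ * _); apply: eq_bigr => s _; rewrite mxE.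
Qed.

Lemma estimator_error (L c : R) t om : (0 < t)%N -> 0 < c ->
  c < lambda_min (gram (features phi w x a om) t) ->
  (forall s, (0 < s)%N -> `|phi (x s om)| <= L) ->
  (forall s, (0 < s)%N -> \sum_(1 <= r < s) `|w s r| <= L) ->
  (c * t%:R * `|estimator t om - theta|) ^+ 2 <= total_score L t om.
Proof.
move=> t0 c0 clam phiL wL; set z := features phi w x a om.
have Gunit : gram z t \in unitmx.
  by apply: lambda_min_unitmx; [exact: tr_gram|exact: lt_trans clam].
rewrite /Defs.estimator theta_hatB// -/z.
set v := t%:R^-1 *: _.
have vE j : v j 0 = t%:R^-1 * score L j t om.
  rewrite mxE summxE; congr (_ * _); apply: eq_big_nat => s /andP[s0 _].
  rewrite mxE /Defs.reward meanE -/z addrAC subrr add0r mulrC clip_id//.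
  by apply: ler_norm_zvec; [exact: phiL|exact: wL].
have tN0 : t%:R != 0 :> R by rewrite pnatr_eq0 -lt0n.
have := lambda_min_invmx v (tr_gram z t) c0 (ltW clam).
set u := invmx _ *m v => ineq.
have -> : total_score L t om = t%:R ^+ 2 * \sum_j v j 0 ^+ 2.
  rewrite mulr_sumr; apply: eq_bigr => j _.
  by rewrite vE exprMn mulrA exprVn divff ?mul1r// expf_neq0.
rewrite exprMn [_ * t%:R]mulrC exprMn -mulrA ler_wpM2l ?sqr_ge0//.
apply: le_trans ineq; rewrite ler_wpM2l ?sqr_ge0//.
(* The norm of the estimation error is the sup norm: a nonzero [u] attains it at an entry, whose
   square is one term of the Euclidean sum. *)
have [->|u0] := eqVneq u 0.
  by rewrite normr0 expr0n sumr_ge0// => j _; rewrite sqr_ge0.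
have uN0 : mx_norm u != 0 by rewrite -[mx_norm u]/`|u| normr_eq0.
have [[i k] /= uE] := mx_norm_neq0 uN0; rewrite -[`|u|]/(mx_norm u) uE.
rewrite (ord1 k) real_normK ?num_real// (bigD1 i)//= lerDl.
by apply: sumr_ge0 => j _; rewrite sqr_ge0.
Qed.

Lemma estimator_deviation (L c h : R) t : (0 < t)%N -> 0 < c -> 0 < h -> 0 <= L ->
  {ae P, forall om, c < lambda_min (gram (features phi w x a om) t)} ->
  {ae PX, forall v, `|phi v| <= L} ->
  (forall s, (0 < s)%N -> \sum_(1 <= r < s) `|w s r| <= L) ->
  (P [set om | (h < `|estimator t om - theta|)%R] <=
   ((d1 + d1 + 1)%:R * (L ^+ 2 * noise_bound) / h ^+ 2 / (t%:R * c ^+ 2))%:E)%E.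
Proof.
move=> t0 c0 h0 L0 clip phiL wL.
(* Each context has law [PX], so the exceptional null set pulls back to a null set at every time;
   countably many of them are discarded at once. The shift [s.+1] skips the irrelevant index 0. *)
have phixL : {ae P, forall om, forall s, (0 < s)%N -> `|phi (x s om)| <= L}.
  have [N [mN N0 phiN]] := phiL.
  have : P.-negligible (\bigcup_s (x s.+1 @^-1` N)).
    apply: negligible_bigcup => s; exists (x s.+1 @^-1` N); split => //.
      by rewrite -[X in measurable X]setTI; exact: (model_x hmodel s.+1).
    by rewrite -[RHS]N0; exact: (model_x_law hmodel (ltn0Sn s) mN).
  apply: negligibleS => om /= /existsNP[s /not_implyP[s0 phis]].
  by exists s.-1 => //=; rewrite prednK//; apply: phiN.
(* The level for Markov's inequality: an error above [h] forces [total_score] above [b], of order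
   [t^2 c^2], while its mean is of order [t]. *)
pose b := (c * t%:R * h) ^+ 2.
have tgt0 : 0 < t%:R :> R by rewrite ltr0n.
have b0 : 0 < b by rewrite exprn_gt0// !mulr_gt0.
have mpred (p : Omega -> bool) : measurable_fun setT p -> measurable [set om | p om].
  by move=> mp; rewrite -[X in measurable X]setTI; exact: (mp measurableT [set true]).
have mA : measurable [set om | h < `|estimator t om - theta|].
  apply: mpred; apply: measurable_fun_ltr => //.
  apply: measurable_mx_norm => i j; rewrite (ord1 j).
  rewrite (_ : (fun _ => _) = fun om => estimator t om i 0 - theta i 0).
    by apply: measurable_funB => //; exact: measurable_estimator.
  by apply/funext => om; rewrite [LHS]mxE [X in _ + X]mxE.
have mB : measurable [set om | b <= total_score L t om].
  by apply: mpred; apply: measurable_fun_ler => //; exact: measurable_total_score.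
apply: (@le_trans _ _ (P [set om | b <= total_score L t om])).
  apply: ae_le_measure => //; apply: filterS2 clip phixL => om /= clam phis hlt.
  apply: le_trans (estimator_error t0 c0 clam phis wL).
  by rewrite /b ler_pXn2r// ?nnegrE ?mulr_ge0// ?ltW// ltr_pM2l// mulr_gt0.
rewrite -(@lee_pmul2l _ b%:E)// ?lte_fin//.
apply: le_trans
  (markov_ge0 P b0 (@measurable_total_score L t) (total_score_ge0 L t)) _.
apply: le_trans (total_score_mean t L0) _; rewrite -EFinM lee_fin le_eqVlt.
apply/orP; left; apply/eqP; rewrite /b; field.
by rewrite !gt_eqF.
Qed.

End noise.

Theorem corollary3
  (R : realType) (d : measure_display) (Omega : measurableType d)
  (P : probability Omega R) (d0 d1 : nat)
  (PX : probability (d0.-tuple R) R) (Pe : bool -> probability R R)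
  (phi : d0.-tuple R -> 'cV[R]_d1) (w : nat -> nat -> R)
  (beta0 beta1 : 'cV[R]_d1) (gamma sigma : R) (sigma_ : bool -> R)
  (x : nat -> Omega -> d0.-tuple R) (a : nat -> Omega -> bool)
  (e : nat -> Omega -> R)
  (C kappa0 : R) (K T0 L : nat) (eps : nat -> R)
  (draw : nat -> Omega -> bool) (pull : nat -> Omega -> Prop)
  (Lx lam Lz : R)
  (hsigma : 0 < sigma) (hL : (0 < L)%N)
  (hmodel : bandit_model P PX Pe phi w beta0 beta1 gamma sigma sigma_ x a e)
  (hfront : front P phi w beta0 beta1 gamma x a e
              C kappa0 K T0 L eps draw pull)
  (hbound : boundedness PX phi w Lx lam Lz)
  (hclip : clipping P phi w x a C T0 eps)
  (heps : t%:R * eps t ^+ 2 @[t --> \oo] --> +oo) :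
  cvg_in_probability P (estimator phi w beta0 beta1 gamma x a e)
    (stack beta0 beta1 gamma).
Proof.
move: hbound hclip => [[Lx0 _] phiLx _ LxLz wLz] [C0 clip] h h0.
have Lz0 : 0 <= Lz by rewrite (le_trans _ LxLz)// ltW.
have phiLz : {ae PX, forall v, `|phi v| <= Lz}.
  by apply: filterS phiLx => v /le_trans; apply.
(* The part independent of [t] in the bound of [estimator_deviation] at [c = C * eps t]. *)
set b := (d1 + d1 + 1)%:R * (Lz ^+ 2 * noise_bound sigma) / h ^+ 2 / C ^+ 2.
have teps_gt0 : \forall t \near \oo, 0 < t%:R * eps t ^+ 2.
  by have /cvgryPgt := heps; apply.
have bound0 : (b / (t%:R * eps t ^+ 2))%:E @[t --> \oo] --> 0%:E.
  apply: cvg_EFin; first exact: nearW.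
  rewrite -[X in _ --> X](mulr0 b); apply: cvgM; first exact: cvg_cst.
  exact/(gtr0_cvgV0 teps_gt0).
apply: squeeze_cvge (cvg_cst 0%E) bound0.
near=> t; rewrite measure_ge0/=.
have T0t : (T0 < t)%N by near: t; exact: nbhs_infty_gt.
have t0 : (0 < t)%N by exact: leq_trans T0t.
have /andP[eps_ge0 _] := front_eps hfront T0t.
(* Only [0 <= eps t] is given; the divergence of [t eps_t^2] excludes zero for large [t]. *)
have eps_gt0 : 0 < eps t.
  rewrite lt0r eps_ge0 andbT; apply/eqP => eps0.
  have : 0 < t%:R * eps t ^+ 2 by near: t.
  by rewrite eps0 expr0n mulr0 ltxx.
have Ceps0 : 0 < C * eps t by rewrite mulr_gt0.
apply: le_trans (estimator_deviation hmodel t0 Ceps0 h0 Lz0 (clip t T0t) phiLz wLz) _.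
rewrite lee_fin le_eqVlt; apply/orP; left; apply/eqP; rewrite /b; field.
by rewrite !gt_eqF// ltr0n.
Unshelve. all: by end_near.
Qed.
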